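(* Every uniform matroid $\mathsf{U}_{k,n}$ ($0\le k\le n$) is $\gamma$-positive. Moreover, the constant term of $\gamma_{\mathsf{U}_{k,n}}(t)$ is $1$, and for each integer $i$ with $0<i<k$, \[ [t^i]\gamma_{\mathsf{U}_{k,n}}(t)=\frac{1}{k-i}\binom{k-i}{i}\sum_{j=i}^{k-1}(k-j)\binom{j-1}{i-1}\binom{n-k+j-1}{j}.\]
   Context: $\mathsf{U}_{k,n}$ is the uniform matroid of rank $k$ on $n$ elements; $[t^i]f(t)$ denotes the coefficient of $t^i$ in $f$. For a matroid $\mathsf{M}$ with lattice of flats $\mathscr{L}(\mathsf{M})$ and flat $F$, $\mathsf{M}^F$ is the localization (matroid on $F$ whose flats are the flats of $\mathsf{M}$ contained in $F$) and $\mathsf{M}_F$ the contraction (matroid on $E\smallsetminus F$ whose flats are $F'\smallsetminus F$ for flats $F'\supseteq F$); $\chi_{\mathsf{M}}$ is the characteristic polynomial. The Kazhdan–Lusztig polynomial $P_{\mathsf{M}}(t)$ is the unique assignment such that: if $\operatorname{rk}(\mathsf{M})=0$ then $P_{\mathsf{M}}=1$ if the ground set is empty and $0$ otherwise; if $\operatorname{rk}(\mathsf{M})>0$ then $\deg P_{\mathsf{M}}<\operatorname{rk}(\mathsf{M})/2$; and $t^{\operatorname{rk}(\mathsf{M})}P_{\mathsf{M}}(t^{-1})=\sum_{F}\chi_{\mathsf{M}^F}(t)P_{\mathsf{M}_F}(t)$. The $Z$-polynomial is $Z_{\mathsf{M}}(t)=\sum_{F\in\mathscr{L}(\mathsf{M})}t^{\operatorname{rk}(F)}P_{\mathsf{M}_F}(t)$;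 it satisfies $Z_{\mathsf{M}}(t)=t^{\operatorname{rk}(\mathsf{M})}Z_{\mathsf{M}}(t^{-1})$. The $\gamma$-polynomial $\gamma_{\mathsf{M}}(t)=\sum_i\gamma_i t^i$ is the unique integer polynomial with $Z_{\mathsf{M}}(t)=\sum_{i=0}^{\lfloor \operatorname{rk}(\mathsf{M})/2\rfloor}\gamma_i t^i(1+t)^{\operatorname{rk}(\mathsf{M})-2i}$. A matroid is $\gamma$-positive if all coefficients of its $\gamma$-polynomial are non-negative. *)

(* Defs.v *)
From HB Require Import structures.
From mathcomp Require Import all_boot all_order all_algebra.
From mathcomp Require Import zify.

Set Implicit Arguments.
Unset Strict Implicit.
Unset Printing Implicit Defensive.

Import GRing.Theory.
Local Open Scope ring_scope.

(* Rank axioms of a matroid on the ground set E, a subset of T. The rank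
   function is extended to all subsets of T; the first axiom together with
   submodularity forces r A = r (A :&: E), so the extension adds no data. *)
Definition matroid_axiom (T : finType) (E : {set T})
    (r : {ffun {set T} -> nat}) : bool :=
  [&& [forall A : {set T}, r A <= #|A :&: E|],
      [forall A : {set T}, forall B : {set T}, (A \subset B) ==> (r A <= r B)] &
      [forall A : {set T}, forall B : {set T},
         r (A :|: B) + r (A :&: B) <= r A + r B]]%N.

Record matroid (T : finType) : Type := Matroid {
  ground : {set T};
  rk_fun : {ffun {set T} -> nat};
  matroidP : matroid_axiom ground rk_fun }.

Definition rk (T : finType) (M : matroid T) (A : {set T}) : nat := rk_fun M A.

Definition rank (T : finType) (M : matroid T) : nat := rk M (ground M).

Definition flats (T : finType) (M : matroid T) : {set {set T}} :=
  [set F : {set T} | (F \subset ground M) &&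
     [forall x in ground M :\: F, rk M F < rk M (x |: F)]%N].

Lemma matroidI (T : finType) (E : {set T}) (r : {set T} -> nat) :
  (forall A : {set T}, r A <= #|A :&: E|)%N ->
  (forall A B : {set T}, A \subset B -> r A <= r B)%N ->
  (forall A B : {set T}, r (A :|: B) + r (A :&: B) <= r A + r B)%N ->
  matroid_axiom E [ffun A => r A].
Proof.
move=> h1 h2 h3; apply/and3P; split; first by apply/forallP=> A; rewrite ffunE.
- by apply/forallP=> A; apply/forallP=> B; apply/implyP; rewrite !ffunE; apply: h2.
- by apply/forallP=> A; apply/forallP=> B; rewrite !ffunE.
Qed.

Lemma setDUK (T : finType) (A F : {set T}) : (A :\: F) :|: F = A :|: F.
Proof. by apply/setP=> x; rewrite !inE; case: (x \in F); rewrite ?orbT ?orbF. Qed.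

Lemma rk_card (T : finType) (M : matroid T) A : (rk M A <= #|A :&: ground M|)%N.
Proof. by have /and3P[/forallP h _ _] := matroidP M; apply: h. Qed.

Lemma rk_mono (T : finType) (M : matroid T) (A B : {set T}) :
  A \subset B -> (rk M A <= rk M B)%N.
Proof.
by have /and3P[_ /forallP h _] := matroidP M; exact: (implyP (forallP (h A) B)).
Qed.

Lemma rk_submod (T : finType) (M : matroid T) A B :
  (rk M (A :|: B) + rk M (A :&: B) <= rk M A + rk M B)%N.
Proof. by have /and3P[_ _ /forallP h] := matroidP M; exact: (forallP (h A) B). Qed.

Lemma rk_setI (T : finType) (M : matroid T) A : rk M (A :&: ground M) = rk M A.
Proof.
apply/eqP; rewrite eqn_leq rk_mono ?subsetIl //=.
have := rk_submod M (A :&: ground M) (A :\: ground M).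
rewrite setID; have := rk_card M (A :\: ground M).
have -> : (A :\: ground M) :&: ground M = set0.
  by apply/setP=> x; rewrite !inE; case: (x \in ground M); rewrite ?andbF.
by rewrite cards0; lia.
Qed.

Lemma matroid_eq (T : finType) (M N : matroid T) :
  ground M = ground N -> {in powerset (ground M), rk M =1 rk N} -> M = N.
Proof.
move=> e h; have {h} : rk M =1 rk N.
  by move=> A; rewrite -rk_setI -(rk_setI N) -e h // powersetE subsetIr.
case: M N e => [E r p] [E' r' p'] /= e; rewrite /rk /= => /ffunP e'.
by case: _ / e in p' *; case: _ / e' in p' *; congr Matroid; apply: bool_irrelevance.
Qed.

Fact localization_subproof (T : finType) (M : matroid T) (F : {set T}) :
  matroid_axiom (ground M :&: F) [ffun A => rk M (A :&: F)].
Proof.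
apply: matroidI => [A|A B sAB|A B].
- by rewrite (leq_trans (rk_card _ _)) // setIAC setIA.
- by rewrite rk_mono // setSI.
- by rewrite setIUl setIIl rk_submod.
Qed.

(* The restriction M^F to F. *)
Definition localization (T : finType) (M : matroid T) (F : {set T}) : matroid T :=
  Matroid (localization_subproof M F).

Fact contraction_subproof (T : finType) (M : matroid T) (F : {set T}) :
  matroid_axiom (ground M :\: F) [ffun A => rk M (A :|: F) - rk M F]%N.
Proof.
apply: matroidI => [A|A B sAB|A B].
- have := rk_submod M (A :\: F) F; have := rk_card M (A :\: F).
  rewrite setDUK; have -> : (A :\: F) :&: ground M = A :&: (ground M :\: F).
    by rewrite setIDAC setIDA.
  lia.
- by rewrite leq_sub2r // rk_mono // setSU.
- have := rk_submod M (A :|: F) (B :|: F); rewrite -setUIl -setUUl.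
  by have := rk_mono M (subsetUr (A :&: B) F); have := rk_mono M (subsetUr A F);
     have := rk_mono M (subsetUr B F); have := rk_mono M (subsetUr (A :|: B) F); lia.
Qed.

(* M_F, on the ground set E minus F. *)
Definition contraction (T : finType) (M : matroid T) (F : {set T}) : matroid T :=
  Matroid (contraction_subproof M F).

Fact uniform_subproof (k n : nat) :
  matroid_axiom [set: 'I_n] [ffun A : {set 'I_n} => minn #|A| k].
Proof.
apply: matroidI => [A|A B sAB|A B].
- by rewrite setIT geq_minl.
- by have := subset_leq_card sAB; lia.
- have := cardsUI A B; have := subset_leq_card (subsetUl A B).
  by have := subset_leq_card (subsetUr A B); lia.
Qed.

(* This is U_{k,n} for k <= n; for k > n it is U_{n,n}. *)
Definition uniform (k n : nat) : matroid 'I_n := Matroid (uniform_subproof k n).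

Lemma rk_localization (T : finType) (M : matroid T) F A :
  rk (localization M F) A = rk M (A :&: F).
Proof. by rewrite /rk ffunE. Qed.

Lemma rk_contraction (T : finType) (M : matroid T) F A :
  rk (contraction M F) A = (rk M (A :|: F) - rk M F)%N.
Proof. by rewrite /rk ffunE. Qed.

Lemma rk_uniform k n (A : {set 'I_n}) : rk (uniform k n) A = minn #|A| k.
Proof. by rewrite /rk ffunE. Qed.

Lemma rank_uniform k n : (k <= n)%N -> rank (uniform k n) = k.
Proof. by rewrite /rank rk_uniform cardsT card_ord => /minn_idPr. Qed.

Lemma flatP (T : finType) (M : matroid T) (F : {set T}) :
  reflect (F \subset ground M /\
           forall x, x \in ground M -> x \notin F -> (rk M F < rk M (x |: F))%N)
          (F \in flats M).
Proof.
rewrite inE; apply: (iffP andP) => -[sF h]; split=> //.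
  by move=> x xE xF; move/forallP/(_ x)/implyP: h; apply; rewrite inE xF.
by apply/forallP=> x; apply/implyP; rewrite inE => /andP[xF xE]; apply: h.
Qed.

Lemma flat_sub (T : finType) (M : matroid T) F : F \in flats M -> F \subset ground M.
Proof. by case/flatP. Qed.

Lemma rk_closed (T : finType) (M : matroid T) (A B : {set T}) x :
  A \subset B -> rk M (x |: A) = rk M A -> rk M (x |: B) = rk M B.
Proof.
move=> sAB e; apply/eqP; rewrite eqn_leq [X in _ && X]rk_mono ?subsetUr // andbT.
have := rk_submod M (x |: A) B; rewrite -setUA (setUidPr sAB) e.
have : (rk M A <= rk M ((x |: A) :&: B))%N.
  by rewrite rk_mono // subsetI sAB subsetUr.
lia.
Qed.

Lemma flats_localization (T : finType) (M : matroid T) F :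
  F \in flats M -> flats (localization M F) = [set G in flats M | G \subset F].
Proof.
move=> fF; have sF := flat_sub fF; apply/setP=> G; rewrite [RHS]inE.
apply/flatP/andP => /= [[sG h]|[/flatP[sG h] sGF]].
  have sGF : G \subset F by move: sG; rewrite subsetI => /andP[].
  split=> //; apply/flatP; split=> [|x xE xG]; first exact: subset_trans sF.
  have [xF|xF] := boolP (x \in F).
    have := h x; rewrite inE xE xF => /(_ isT xG).
    rewrite !rk_localization (setIidPl sGF) (setIidPl _) //.
    by rewrite subUset sub1set xF.
  rewrite ltn_neqAle rk_mono ?subsetUr // andbT; apply/eqP => e.
  have/flatP[_ /(_ x xE xF)] := fF.
  by rewrite (rk_closed sGF (esym e)) ltnn.
split=> [|x]; first by rewrite subsetI sG.
rewrite inE => /andP[xE xF] xG; rewrite !rk_localization !(setIidPl _) ?h //.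
by rewrite subUset sub1set xF.
Qed.

Lemma flat_contraction (T : finType) (M : matroid T) (F G : {set T}) :
  F \in flats M -> F \subset G -> (G :\: F \in flats (contraction M F)) = (G \in flats M).
Proof.
move=> fF sFG; have sF := flat_sub fF.
have e : (G :\: F) :|: F = G by rewrite setDUK (setUidPl sFG).
have s : (G :\: F \subset ground M :\: F) = (G \subset ground M).
  apply/idP/idP => [h|]; last exact: setSD.
  by rewrite -e subUset sF (subset_trans h) // subsetDl.
have l (H : {set T}) : F \subset H -> (rk M F <= rk M H)%N by apply: rk_mono.
apply/flatP/flatP => /=; rewrite s => -[sG h]; split=> // x.
  move=> xE xG; have xF : x \notin F by apply: contra xG; apply: subsetP.
  have := h x; rewrite !inE xE xF (negPf xG) => /(_ isT isT).
  by rewrite !rk_contraction -setUA e; have := l _ sFG; lia.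
rewrite !inE => /andP[xF xE]; rewrite xF /= => xG.
rewrite !rk_contraction -setUA e; have := h x xE xG.
by have := l _ sFG; lia.
Qed.

Lemma flats_contraction (T : finType) (M : matroid T) F : F \in flats M ->
  flats (contraction M F) = [set G :\: F | G in flats M & F \subset G].
Proof.
move=> fF; apply/setP=> H; apply/idP/imsetP => [fH|[G]]; last first.
  by rewrite inE => /andP[fG sFG] ->; rewrite flat_contraction.
have sH := flat_sub fH; rewrite /= in sH.
have e : (H :|: F) :\: F = H.
  rewrite setDUl setDv setU0; apply/setDidPl.
  by move: sH; rewrite subsetD => /andP[].
exists (H :|: F); rewrite ?e // inE subsetUr andbT.
by rewrite -(flat_contraction fF) ?subsetUr ?e.
Qed.

Lemma contraction0 (T : finType) (M : matroid T) : contraction M set0 = M.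
Proof.
apply: matroid_eq => /= [|A _]; first by rewrite setD0.
have := rk_card M set0; rewrite set0I cards0.
by rewrite rk_contraction setU0; lia.
Qed.

Lemma contraction_contraction (T : finType) (M : matroid T) (F G : {set T}) :
  F \subset G -> contraction (contraction M F) (G :\: F) = contraction M G.
Proof.
move=> sFG; have e : (G :\: F) :|: F = G by rewrite setDUK (setUidPl sFG).
apply: matroid_eq => /= [|A _]; first by rewrite setDDl setUC e.
rewrite !rk_contraction -setUA e.
by have := rk_mono M sFG; have := rk_mono M (subsetUr A G); lia.
Qed.

(* Vanishes when M has a loop. *)
Definition chi_poly (T : finType) (M : matroid T) : {poly int} :=
  \sum_(A : {set T} | A \subset ground M) (-1) ^+ #|A| * 'X^(rank M - rk M A).

(* t^d p(1/t), for p of degree at most d. *)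
Definition rev_poly (d : nat) (p : {poly int}) : {poly int} :=
  \poly_(i < d.+1) p`_(d - i).

Definition is_KL_assignment
    (P : forall T : finType, matroid T -> {poly int}) : Prop :=
  forall (T : finType) (M : matroid T),
    [/\ rank M = 0%N -> P T M = if ground M == set0 then 1 else 0,
        (0 < rank M)%N -> ((size (P T M)).-1.*2 < rank M)%N &
        rev_poly (rank M) (P T M) =
          \sum_(F in flats M) chi_poly (localization M F) * P T (contraction M F)].

Lemma toggle_sum (T : finType) (x : T) (P : pred {set T}) (f : {set T} -> {poly int}) :
  (forall A : {set T}, x \notin A -> P (x |: A) = P A) ->
  (forall A : {set T}, x \notin A -> f (x |: A) = - f A) ->
  \sum_(A | P A) f A = 0.
Proof.
move=> hP hf; rewrite (bigID (fun A : {set T} => x \in A)) /=.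
rewrite (reindex_onto (fun A => x |: A) (fun A => A :\ x)) /=; last first.
  by move=> A /andP[_ xA]; rewrite setD1K.
rewrite (eq_bigl (fun A => P A && (x \notin A))); last first.
  move=> A; rewrite setU11 andbT; have [xA|xA] := boolP (x \in A).
    rewrite andbF; apply/negbTE/negP => /andP[_ /eqP e].
    by move: xA; rewrite -e !inE eqxx.
  by rewrite hP // setU1K // eqxx.
rewrite -big_split big1 //= => A /andP[_ xA].
by rewrite hf // addNr.
Qed.

Lemma card_toggle (T : finType) (x : T) (B F : {set T}) : x \notin F -> x \notin B ->
  #|(x |: B) :\: F| = #|B :\: F|.+1.
Proof.
move=> xF xB; have -> : (x |: B) :\: F = x |: (B :\: F).
  by apply/setP=> y; rewrite !inE; case: eqP => // ->; rewrite xF.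
by rewrite cardsU1 inE (negPf xB) andbF.
Qed.

Lemma alt_sum (T : finType) (A B : {set T}) : A \subset B ->
  \sum_(F : {set T} | (A \subset F) && (F \subset B)) (-1) ^+ #|B :\: F|
    = (A == B)%:R :> {poly int}.
Proof.
move=> sAB; case: eqVneq => [->|nAB].
  rewrite (big_pred1 B) ?setDv ?cards0 ?expr0 // => F.
  by rewrite /= eqEsubset andbC.
have /subsetPn[x xB xA] : ~~ (B \subset A) by rewrite eqEsubset sAB in nAB.
apply: (toggle_sum (x := x)) => [C xC|C xC].
  rewrite subUset sub1set xB /=; congr (_ && _).
  apply/idP/idP => h; last exact: subset_trans (subsetUr _ _).
  apply/subsetP=> y yA; have := subsetP h y yA; rewrite !inE.
  by case: eqP => // e; rewrite e (negPf xA) in yA.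
have -> : B :\: C = x |: (B :\: (x |: C)).
  apply/setP=> y; rewrite !inE; case: eqP => // ->; by rewrite xC xB.
by rewrite cardsU1 !inE eqxx /= add1n exprS mulN1r opprK.
Qed.

(* For flats F <= G of M, the characteristic polynomial of (M_F)^(G :\: F). *)
Definition chi_itv (T : finType) (M : matroid T) (F G : {set T}) : {poly int} :=
  \sum_(B : {set T} | (F \subset B) && (B \subset G))
     (-1) ^+ #|B :\: F| * 'X^(rk M G - rk M B).

Lemma chi_itv_eq0 (T : finType) (M : matroid T) (F G : {set T}) x :
  x \in G -> x \notin F -> rk M (x |: F) = rk M F -> chi_itv M F G = 0.
Proof.
move=> xG xF e.
rewrite /chi_itv (eq_bigr (fun B : {set T} => if F \subset B then
    (-1) ^+ #|B :\: F| * 'X^(rk M G - rk M B) else 0)); last first.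
  by move=> B /andP[->].
apply: (toggle_sum (x := x)) => A xA.
  rewrite subUset sub1set xG; congr (_ && _).
  apply/idP/idP => h; last exact: subset_trans (subsetUr _ _).
  apply/subsetP=> y yA; have := subsetP h y yA; rewrite !inE.
  by case: eqP => // e'; rewrite e' (negPf xF) in yA.
have -> : (F \subset x |: A) = (F \subset A).
  apply/idP/idP => h; last exact: subset_trans (subsetUr _ _).
  apply/subsetP=> y yA; have := subsetP h y yA; rewrite !inE.
  by case: eqP => // e'; rewrite e' (negPf xF) in yA.
case: ifP => [sFA|]; last by rewrite oppr0.
by rewrite card_toggle // exprS mulN1r (rk_closed sFA e) mulNr.
Qed.

Lemma chi_itv_nonflat (T : finType) (M : matroid T) (F G : {set T}) :
  G \in flats M -> F \subset G -> F \notin flats M -> chi_itv M F G = 0.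
Proof.
move=> fG sFG; rewrite inE negb_and (subset_trans sFG (flat_sub fG)) /=.
rewrite negb_forall => /existsP[x]; rewrite negb_imply -leqNgt inE.
case/andP=> /andP[xF xE] le.
have e : rk M (x |: F) = rk M F.
  by apply/eqP; rewrite eqn_leq le rk_mono // subsetUr.
apply: (@chi_itv_eq0 _ _ _ _ x) => //; apply: contraTT fG => xG.
apply/negP => /flatP[_ /(_ x xE xG)].
by rewrite (rk_closed sFG e) ltnn.
Qed.

Lemma chi_localization (T : finType) (M : matroid T) F : F \in flats M ->
  chi_poly (localization M F) = chi_itv M set0 F.
Proof.
move=> fF; rewrite /chi_poly /chi_itv /rank /= (setIidPr (flat_sub fF)).
apply: eq_big => [A|A sA]; first by rewrite sub0set.
by rewrite setD0 !rk_localization setIid (setIidPl sA).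
Qed.

Lemma chi_itv_contraction (T : finType) (M : matroid T) (F G : {set T}) : F \subset G ->
  chi_itv (contraction M F) set0 (G :\: F) = chi_itv M F G.
Proof.
move=> sFG; rewrite /chi_itv.
have e : (G :\: F) :|: F = G by rewrite setDUK (setUidPl sFG).
rewrite (reindex_onto (fun B => B :\: F) (fun B => B :|: F)) /=; last first.
  move=> B; rewrite sub0set /= subsetD => /andP[_ d].
  by rewrite setDUl setDv setU0; apply/setDidPl.
apply: eq_big => [B|B /andP[_ /eqP eB]].
  rewrite sub0set /= setDUK; apply/andP/andP => [[sB /eqP <-]|[sFB sBG]].
    rewrite subsetUr subUset sFG andbT; split=> //.
    apply/subsetP=> y yB; rewrite -e inE; case: (boolP (y \in F)); rewrite ?orbT // orbF.
    by move=> yF; apply: (subsetP sB); rewrite inE yF.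
  by rewrite setSD // (setUidPl sFB).
rewrite setD0 !rk_contraction e eB.
have := rk_mono M (subsetUr (B :\: F) F); have := rk_mono M sFG; rewrite eB => l1 l2.
congr (_ * 'X^_); lia.
Qed.

Lemma sum_chi_itv (T : finType) (M : matroid T) (A G : {set T}) :
  G \in flats M -> A \subset G ->
  \sum_(F in flats M | (A \subset F) && (F \subset G)) chi_itv M F G
     = 'X^(rk M G - rk M A).
Proof.
move=> fG sAG.
transitivity (\sum_(F : {set T} | (A \subset F) && (F \subset G)) chi_itv M F G).
  rewrite [RHS](bigID (mem (flats M))) /= [X in _ + X]big1 ?addr0.
    by apply: eq_bigl => F; rewrite andbC.
  by move=> F /andP[/andP[_ sFG] nF]; apply: chi_itv_nonflat.
rewrite /chi_itv (exchange_big_dep (fun B : {set T} => (A \subset B) && (B \subset G))) /=.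
  rewrite (bigD1 A) ?subxx //= [X in _ + X]big1 ?addr0 => [|B /andP[/andP[sAB sBG] nB]].
    rewrite (big_pred1 A) ?setDv ?cards0 ?expr0 ?mul1r // => F /=.
    apply/idP/eqP => [/andP[/andP[h _] /andP[h' _]]|->]; last by rewrite !subxx sAG.
    by apply/eqP; rewrite eqEsubset h h'.
  rewrite -mulr_suml (eq_bigl (fun F : {set T} => (A \subset F) && (F \subset B))).
    by rewrite alt_sum // eq_sym (negPf nB) mul0r.
  move=> F; rewrite sBG andbT; apply/andP/andP => [[/andP[-> _] ->]//|[-> sFB]].
  by rewrite sFB (subset_trans sFB).
by move=> F B /andP[sAF _] /andP[sFB ->]; rewrite (subset_trans sAF).
Qed.

Lemma coef_rev d p i : (rev_poly d p)`_i = if (i <= d)%N then p`_(d - i) else 0.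
Proof. by rewrite coef_poly ltnS. Qed.

Lemma size_rev d p : (size (rev_poly d p) <= d.+1)%N.
Proof. exact: size_poly. Qed.

Lemma rev_sum (I : Type) (r : seq I) (P : pred I) d (f : I -> {poly int}) :
  rev_poly d (\sum_(i <- r | P i) f i) = \sum_(i <- r | P i) rev_poly d (f i).
Proof.
apply/polyP=> j; rewrite coef_rev !coef_sum; under [RHS]eq_bigr do rewrite coef_rev.
by case: ifP => // _; rewrite big1.
Qed.

Lemma revZX d c m : (m <= d)%N -> rev_poly d (c *: 'X^m) = c *: 'X^(d - m).
Proof.
move=> le; apply/polyP=> j; rewrite coef_rev !coefZ !coefXn.
case: (leqP j d) => lj; last by rewrite (_ : (j == _) = false) ?mulr0 //; lia.
by congr (_ * _%:R); lia.
Qed.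

Lemma revE d p : rev_poly d p = \sum_(i < d.+1) p`_i *: 'X^(d - i).
Proof.
rewrite /rev_poly poly_def (reindex_inj rev_ord_inj) /=.
apply: eq_bigr => i _; rewrite subSS; congr (p`_ _ *: _); have := ltn_ord i; lia.
Qed.

Lemma poly_sumE d (p : {poly int}) : (size p <= d.+1)%N ->
  p = \sum_(i < d.+1) p`_i *: 'X^i.
Proof.
move=> le; rewrite -poly_def; apply/polyP=> i; rewrite coef_poly.
by case: ltnP => // l; rewrite nth_default // (leq_trans le).
Qed.

Lemma revM a b (p q : {poly int}) : (size p <= a.+1)%N -> (size q <= b.+1)%N ->
  rev_poly (a + b) (p * q) = rev_poly a p * rev_poly b q.
Proof.
move=> sp sq; rewrite [rev_poly a p]revE [rev_poly b q]revE {1}(poly_sumE sp) {1}(poly_sumE sq).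
rewrite !mulr_suml rev_sum.
apply: eq_bigr => i _; rewrite !mulr_sumr rev_sum; apply: eq_bigr => j _.
have li := ltn_ord i; have lj := ltn_ord j.
rewrite -!scalerAl -!scalerAr !scalerA -!exprD revZX; last by lia.
by congr (_ *: 'X^_); lia.
Qed.

Lemma signXE n m : (-1) ^+ n * 'X^m = ((-1) ^+ n : int) *: 'X^m :> {poly int}.
Proof.
rewrite -signr_odd -[in RHS]signr_odd; case: (odd n).
  by rewrite expr1 mulN1r scaleN1r.
by rewrite expr0 mul1r scale1r.
Qed.

Lemma rev_chi_itv (T : finType) (M : matroid T) (F : {set T}) :
  rev_poly (rk M F) (chi_itv M set0 F) =
  \sum_(A : {set T} | A \subset F) (-1) ^+ #|A| * 'X^(rk M A).
Proof.
rewrite /chi_itv rev_sum; apply: eq_big => [A|A /andP[_ sA]]; first by rewrite sub0set.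
rewrite setD0 !signXE revZX ?leq_subr // subKn //; exact: rk_mono.
Qed.

Lemma size_chi_itv (T : finType) (M : matroid T) (F G : {set T}) :
  (size (chi_itv M F G) <= (rk M G).+1)%N.
Proof.
rewrite (leq_trans (size_sum _ _ _)) //; apply/bigmax_leqP => B _.
by rewrite signXE (leq_trans (size_scale_leq _ _)) // size_polyXn ltnS leq_subr.
Qed.

Lemma chi_kernel (T : finType) (M : matroid T) (G : {set T}) : G \in flats M ->
  \sum_(F in flats M | F \subset G)
     rev_poly (rk M F) (chi_itv M set0 F) * chi_itv M F G = (G == set0)%:R.
Proof.
move=> fG; under eq_bigr do rewrite rev_chi_itv mulr_suml.
rewrite (exchange_big_dep (fun A : {set T} => A \subset G)) /=; last first.
  by move=> F A /andP[_ sFG] sAF; apply: subset_trans sFG.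
transitivity (\sum_(A : {set T} | A \subset G)
   (-1) ^+ #|G| * 'X^(rk M G) * (-1) ^+ #|G :\: A| : {poly int}).
  apply: eq_bigr => A sAG; rewrite -mulr_sumr.
  rewrite (eq_bigl (fun F => (F \in flats M) && ((A \subset F) && (F \subset G)))); last first.
    by move=> F; rewrite -andbA (andbC (F \subset G)).
  rewrite sum_chi_itv // -[LHS]mulrA -exprD subnKC ?rk_mono // mulrAC -exprD.
  have -> : (#|G| + #|G :\: A| = #|A| + #|G :\: A|.*2)%N.
    by rewrite -(cardsID A G) (setIidPr sAG); lia.
  by rewrite exprD -mul2n exprM sqrrN expr1n expr1n mulr1.
rewrite -mulr_sumr (eq_bigl (fun A : {set T} => (set0 \subset A) && (A \subset G))); last first.
  by move=> A; rewrite sub0set.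
rewrite alt_sum ?sub0set // eq_sym; case: eqVneq => [->|_]; rewrite ?mulr0 //.
have := rk_card M set0; rewrite set0I cards0 leqn0 => /eqP ->.
by rewrite !mulr1.
Qed.

(* kl_rec and kl_sol only serve to prove kl_exists: the coefficients of P_M in
   degree < rk(M)/2 can be read off the terms of the recursion with F nonempty. *)
Fixpoint kl_rec (T : finType) (n : nat) (M : matroid T) : {poly int} :=
  if n is n'.+1 then
    if rank M == 0%N then if ground M == set0 then 1 else 0 else
    - \poly_(i < uphalf (rank M)) (\sum_(F in flats M | F != set0)
        chi_poly (localization M F) * kl_rec n' (contraction M F))`_i
  else 0.

Lemma card_contraction (T : finType) (M : matroid T) (F : {set T}) :
  F \in flats M -> F != set0 -> (#|ground (contraction M F)| < #|ground M|)%N.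
Proof.
move=> fF nF /=; rewrite cardsD (setIidPr (flat_sub fF)).
have := subset_leq_card (flat_sub fF); rewrite -card_gt0 in nF; lia.
Qed.

Lemma kl_rec_stable (T : finType) n m (M : matroid T) :
  (#|ground M| < n)%N -> (#|ground M| < m)%N -> kl_rec n M = kl_rec m M.
Proof.
elim: n m M => // n IH [//|m] M ln lm /=; case: ifP => // _; congr (- _).
apply/polyP=> i; rewrite !coef_poly; case: ifP => // _; congr (nth _ (polyseq _) _).
apply: eq_bigr => F /andP[fF nF]; have := card_contraction fF nF => l.
by rewrite (IH m) //; apply: leq_trans l _.
Qed.

Definition kl_sol (T : finType) (M : matroid T) := kl_rec #|ground M|.+1 M.

Definition kl_rest (T : finType) (M : matroid T) : {poly int} :=
  \sum_(F in flats M | F != set0)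
     chi_poly (localization M F) * kl_sol (contraction M F).

Lemma kl_solE (T : finType) (M : matroid T) : kl_sol M =
    if rank M == 0%N then if ground M == set0 then 1 else 0 else
    - \poly_(i < uphalf (rank M)) (kl_rest M)`_i.
Proof.
rewrite {1}/kl_sol /=; case: ifP => // _; congr (- _).
apply/polyP=> i; rewrite !coef_poly; case: ifP => // _; congr (nth _ (polyseq _) _).
apply: eq_bigr => F /andP[fF nF]; have := card_contraction fF nF => l.
by congr (_ * _); apply: kl_rec_stable.
Qed.

Lemma size_kl_pos (T : finType) (M : matroid T) :
  (0 < rank M)%N -> (size (kl_sol M) <= uphalf (rank M))%N.
Proof. by rewrite kl_solE lt0n => /negbTE ->; rewrite size_polyN size_poly. Qed.

Lemma size_kl (T : finType) (M : matroid T) : (size (kl_sol M) <= (rank M).+1)%N.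
Proof.
case: (posnP (rank M)) => [r0|/size_kl_pos]; last by lia.
by rewrite kl_solE r0 eqxx; case: ifP; rewrite ?size_poly1 ?size_poly0.
Qed.

Lemma rank_contraction (T : finType) (M : matroid T) F : F \in flats M ->
  rank (contraction M F) = (rank M - rk M F)%N.
Proof.
by move=> fF; rewrite /rank rk_contraction /= setDUK (setUidPl (flat_sub fF)).
Qed.

Lemma chi_loop (T : finType) (M : matroid T) F :
  set0 \notin flats M -> F \in flats M -> chi_poly (localization M F) = 0.
Proof.
by move=> n0 fF; rewrite chi_localization // chi_itv_nonflat // sub0set.
Qed.

Lemma sum_contraction (T : finType) (M : matroid T) F (f : matroid T -> {poly int}) :
  F \in flats M ->
  \sum_(H in flats (contraction M F))
     chi_poly (localization (contraction M F) H) * f (contraction (contraction M F) H)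
  = \sum_(G in flats M | F \subset G) chi_itv M F G * f (contraction M G).
Proof.
move=> fF; rewrite flats_contraction // big_imset /=; last first.
  move=> G H; rewrite !inE => /andP[_ sG] /andP[_ sH] e.
  by rewrite -(setUidPl sG) -(setDUK G) e setDUK (setUidPl sH).
apply: eq_big => [G|G]; first by rewrite inE.
rewrite inE => /andP[fG sFG].
rewrite contraction_contraction // chi_localization ?flat_contraction //.
by rewrite chi_itv_contraction.
Qed.

Lemma chi_itv_refl (T : finType) (M : matroid T) (F : {set T}) : chi_itv M F F = 1.
Proof.
rewrite /chi_itv (big_pred1 F) ?setDv ?cards0 ?subnn ?mulr1 // => G.
by rewrite /= eqEsubset andbC.
Qed.

Lemma rev_kl_rest (T : finType) (M : matroid T) : set0 \in flats M ->
  (forall F, F \in flats M -> F != set0 ->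
     rev_poly (rank (contraction M F)) (kl_sol (contraction M F)) =
     \sum_(H in flats (contraction M F)) chi_poly (localization (contraction M F) H) *
        kl_sol (contraction (contraction M F) H)) ->
  rev_poly (rank M) (kl_rest M) = - kl_rest M.
Proof.
move=> f0 IH; rewrite /kl_rest rev_sum.
transitivity (\sum_(F in flats M | F != set0) \sum_(G in flats M | F \subset G)
   rev_poly (rk M F) (chi_itv M set0 F) * chi_itv M F G * kl_sol (contraction M G)).
  apply: eq_bigr => F /andP[fF nF].
  have r : (rank M = rk M F + rank (contraction M F))%N.
    by rewrite rank_contraction // subnKC // rk_mono // flat_sub.
  rewrite {1}r chi_localization // revM ?size_kl ?size_chi_itv // IH //.
  by rewrite sum_contraction // mulr_sumr; apply: eq_bigr => G _; rewrite mulrA.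
rewrite (exchange_big_dep (fun G => (G \in flats M) && (G != set0))) /=; last first.
  move=> F G /andP[_ nF] /andP[-> sFG] /=; apply: contraNneq nF => e.
  by rewrite -subset0 -e.
rewrite -sumrN; apply: eq_bigr => G /andP[fG nG]; rewrite -mulr_suml -mulNr.
congr (_ * _); rewrite chi_localization //; apply/eqP; rewrite -addr_eq0; apply/eqP.
have := chi_kernel fG; rewrite (negPf nG) (bigD1 set0) /= ?f0 ?sub0set //.
rewrite chi_itv_refl addrC => h; rewrite -[RHS]h; congr (_ + _).
  by apply: eq_bigl => F; rewrite fG andbAC.
rewrite (_ : rev_poly _ _ = 1) ?mul1r //.
have := rk_card M set0; rewrite set0I cards0 leqn0 => /eqP ->.
by apply/polyP=> i; rewrite coef_rev !coef1; case: i.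
Qed.

Lemma kl_sol_eq (T : finType) (M : matroid T) :
  rev_poly (rank M) (kl_sol M) =
  \sum_(F in flats M) chi_poly (localization M F) * kl_sol (contraction M F).
Proof.
have [n] := ubnP #|ground M|; elim: n M => // n IHn M lM.
have [f0|nf0] := boolP (set0 \in flats M); last first.
  rewrite big1 => [|F fF]; last by rewrite chi_loop // mul0r.
  have R0 : kl_rest M = 0 by apply: big1 => F /andP[fF _]; rewrite chi_loop // mul0r.
  rewrite kl_solE R0; case: ifP => [/eqP r0|_]; last first.
    by apply/polyP=> i; rewrite coef_rev coefN coef_poly !coef0 if_same oppr0 if_same.
  case: eqVneq => [E0|_]; last by apply/polyP=> i; rewrite coef_rev !coef0 if_same.
  case/negP: nf0; apply/flatP; split; first exact: sub0set.
  by move=> x; rewrite E0 inE.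
rewrite (bigD1 set0) //= -/(kl_rest M) contraction0 chi_localization // chi_itv_refl mul1r.
have [r0|r0] := posnP (rank M).
  have E0 : ground M = set0.
    apply/eqP/set0Pn => -[x xE]; have /flatP[_ /(_ x xE)] := f0.
    rewrite inE => /(_ isT) l; have : (rk M (x |: set0) <= rank M)%N.
      by rewrite rk_mono // setU0 sub1set.
    by rewrite r0; lia.
  rewrite /kl_rest big1 ?addr0 => [|F /andP[/flat_sub]]; last first.
    by rewrite E0 subset0 => ->.
  rewrite kl_solE r0 E0 !eqxx; apply/polyP=> i; rewrite coef_rev !coef1.
  by case: i.
have rR : rev_poly (rank M) (kl_rest M) = - kl_rest M.
  apply: rev_kl_rest => // F fF nF; apply: IHn.
  by have := card_contraction fF nF; lia.
have cR i : (i <= rank M)%N -> (kl_rest M)`_(rank M - i) = - (kl_rest M)`_i.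
  by move=> l; rewrite -coefN -rR coef_rev l.
have hR i : (rank M < i)%N -> (kl_rest M)`_i = 0.
  move=> l; apply: oppr_inj; rewrite -coefN -rR coef_rev oppr0.
  by rewrite leqNgt l.
have cP i : (kl_sol M)`_i = if (i < uphalf (rank M))%N then - (kl_rest M)`_i else 0.
  by rewrite kl_solE (negPf (lt0n_neq0 r0)) coefN coef_poly; case: ifP; rewrite ?oppr0.
apply/polyP=> i; rewrite coef_rev coefD !cP.
case: (leqP i (rank M)) => li; last by rewrite (hR i) // oppr0 if_same addr0.
rewrite cR //; case: (ltngtP i.*2 (rank M)) => h.
- by rewrite ifF ?ifT ?addNr //; lia.
- by rewrite ifT ?ifF ?opprK ?add0r //; lia.
- have := cR i li; rewrite (_ : rank M - i = i)%N; last by lia.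
  move=> e; have -> : (kl_rest M)`_i = 0 by lia.
  by rewrite !oppr0 !if_same addr0.
Qed.

Lemma kl_exists : {P : forall T : finType, matroid T -> {poly int} | is_KL_assignment P}.
Proof.
exists kl_sol => T M; split; last exact: kl_sol_eq.
  by move=> r0; rewrite kl_solE r0.
by move=> r0; have := size_kl_pos r0; lia.
Qed.

Lemma kl_unique (P Q : forall T : finType, matroid T -> {poly int}) :
  is_KL_assignment P -> is_KL_assignment Q -> forall T (M : matroid T), P T M = Q T M.
Proof.
move=> hP hQ T M; have [n] := ubnP #|ground M|; elim: n M => // n IHn M lM.
have [p0 p1 p2] := hP T M; have [q0 q1 q2] := hQ T M.
have [r0|r0] := posnP (rank M); first by rewrite p0 // q0.
have {}p1 := p1 r0; have {}q1 := q1 r0.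
have cP i : (rank M <= i.*2)%N -> (P T M)`_i = 0.
  move=> l; rewrite nth_default //; move: p1 l.
  move: (size _) => z; lia.
have cQ i : (rank M <= i.*2)%N -> (Q T M)`_i = 0.
  move=> l; rewrite nth_default //; move: q1 l.
  move: (size _) => z; lia.
have e : rev_poly (rank M) (P T M) - (if set0 \in flats M then P T M else 0) =
         rev_poly (rank M) (Q T M) - (if set0 \in flats M then Q T M else 0).
  rewrite p2 q2; case: ifP => f0; last first.
    by rewrite !subr0 !big1 // => F fF; rewrite chi_loop ?f0 ?mul0r.
  rewrite !(bigD1 (P := mem (flats M)) set0) //= contraction0 chi_localization // chi_itv_refl !mul1r.
  rewrite ![_ + _ - _]addrAC !subrr !add0r; apply: eq_bigr => F /andP[fF nF].
  by rewrite IHn //; have := card_contraction fF nF; lia.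
apply/polyP=> i; have [l|l] := leqP (rank M) i.*2; first by rewrite cP // cQ.
have := congr1 (fun p : {poly int} => p`_(rank M - i)) e.
rewrite !coefB !coef_rev leq_subr subKn; last by lia.
have -> : (if set0 \in flats M then P T M else 0)`_(rank M - i) = 0.
  by case: ifP; rewrite ?coef0 ?cP //; lia.
have -> : (if set0 \in flats M then Q T M else 0)`_(rank M - i) = 0.
  by case: ifP; rewrite ?coef0 ?cQ //; lia.
by rewrite !subr0.
Qed.

Definition kl_poly : forall T : finType, matroid T -> {poly int} := sval kl_exists.

Lemma kl_polyP : is_KL_assignment kl_poly.
Proof. exact: svalP kl_exists. Qed.

Definition Z_poly (T : finType) (M : matroid T) : {poly int} :=
  \sum_(F in flats M) 'X^(rk M F) * kl_poly (contraction M F).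

Definition is_gamma_poly (T : finType) (M : matroid T) (g : {poly int}) : Prop :=
  (size g <= (rank M)./2.+1)%N /\
  Z_poly M = \sum_(i < (rank M)./2.+1) g`_i *: ('X^i * (1 + 'X) ^+ (rank M - i.*2)).

Lemma size_kl_poly (T : finType) (M : matroid T) : (size (kl_poly M) <= (rank M).+1)%N.
Proof.
have [h0 h1 _] := kl_polyP M.
have [r0|/h1] := posnP (rank M); last by lia.
by rewrite h0 //; case: ifP; rewrite ?size_poly1 ?size_poly0.
Qed.

Lemma Z_poly_size (T : finType) (M : matroid T) : (size (Z_poly M) <= (rank M).+1)%N.
Proof.
rewrite (leq_trans (size_sum _ _ _)) //; apply/bigmax_leqP => F fF.
rewrite (leq_trans (size_polyMleq _ _)) // size_polyXn.
have := size_kl_poly (contraction M F); rewrite rank_contraction //.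
have := rk_mono M (flat_sub fF); rewrite -/(rank M); lia.
Qed.

Lemma Z_poly_palindromic (T : finType) (M : matroid T) :
  rev_poly (rank M) (Z_poly M) = Z_poly M.
Proof.
rewrite /Z_poly rev_sum.
transitivity (\sum_(F in flats M) \sum_(G in flats M | F \subset G)
   chi_itv M F G * kl_poly (contraction M G)).
  apply: eq_bigr => F fF; have [_ _ e] := kl_polyP (contraction M F).
  have r : (rank M = rk M F + rank (contraction M F))%N.
    by rewrite rank_contraction // subnKC // rk_mono // flat_sub.
  rewrite {1}r revM ?size_kl_poly ?size_polyXn // e sum_contraction //.
  by rewrite -[X in rev_poly _ X]scale1r revZX // subnn scale1r mul1r.
rewrite (exchange_big_dep (mem (flats M))) /=; last by move=> F G _ /andP[].
apply: eq_bigr => G fG; rewrite -mulr_suml; congr (_ * _).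
transitivity ('X^(rk M G - rk M set0) : {poly int}).
  rewrite -(sum_chi_itv fG (sub0set G)); apply: eq_bigl => F.
  by rewrite fG sub0set.
have := rk_card M set0; rewrite set0I cards0 leqn0 => /eqP ->.
by rewrite subn0.
Qed.

Lemma size_1X n : size ((1 + 'X : {poly int}) ^+ n) = n.+1.
Proof. by rewrite addrC -[1]opprK -polyC1 -polyCN size_exp_XsubC. Qed.

Lemma coef_1X_bot n : ((1 + 'X : {poly int}) ^+ n)`_0 = 1.
Proof. by rewrite -horner_coef0 horner_exp !hornerE expr1n. Qed.

Lemma rev_1X d : rev_poly d ((1 + 'X) ^+ d) = (1 + 'X) ^+ d.
Proof.
elim: d => [|d IH].
  by apply/polyP=> i; rewrite coef_rev expr0 !coef1; case: i.
rewrite !exprS -[d.+1]add1n revM ?IH ?size_1X //; last by rewrite -[1 + 'X]expr1 size_1X.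
congr (_ * _); apply/polyP=> i; rewrite coef_rev !coefD !coef1 !coefX.
by case: i => [|[|i]].
Qed.

Lemma gamma_expansion d (p : {poly int}) : (size p <= d.+1)%N -> rev_poly d p = p ->
  {g : {poly int} | (size g <= d./2.+1)%N &
     p = \sum_(i < d./2.+1) g`_i *: ('X^i * (1 + 'X) ^+ (d - i.*2))}.
Proof.
have [n] := ubnP d; elim: n d p => // n IH d p ld sp rp.
pose q : {poly int} := p - p`_0 *: (1 + 'X) ^+ d.
have rq : rev_poly d q = q.
  apply/polyP=> i; have := congr1 (fun r : {poly int} => r`_i) rp.
  have := congr1 (fun r : {poly int} => r`_i) (rev_1X d).
  rewrite !coef_rev !coefB !coefZ; case: leqP => l; last by move=> <- <-; rewrite mulr0 subr0.
  by move=> -> ->.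
have q0 : q`_0 = 0 by rewrite coefB coefZ coef_1X_bot mulr1 subrr.
have qd i : (d <= i)%N -> q`_i = 0.
  rewrite leq_eqVlt => /orP[/eqP <-|l]; first by rewrite -rq coef_rev leqnn subnn.
  by rewrite -rq coef_rev leqNgt l.
case: (ltnP d 2) => d2.
  exists (p`_0)%:P; first by rewrite (leq_trans (size_polyC_leq1 _)).
  have -> : d./2 = 0%N by lia.
  rewrite big_ord1 coefC eqxx expr0 mul1r subn0; apply/eqP; rewrite -subr_eq0 -/q.
  apply/eqP/polyP=> i; rewrite coef0; case: i => [//|i]; apply: qd; lia.
case: d d2 ld sp rp @q rq q0 qd => [//|[//|d]] _ ld sp rp q rq q0 qd.
pose q' := \poly_(i < d.+1) q`_i.+1.
have eq' : q = 'X * q'.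
  apply/polyP=> i; rewrite coefXM coef_poly; case: i => [//|i] /=.
  by case: ltnP => // l; apply: qd.
have [g sg eg] : {g : {poly int} | (size g <= d./2.+1)%N &
     q' = \sum_(i < d./2.+1) g`_i *: ('X^i * (1 + 'X) ^+ (d - i.*2))}.
  apply: IH; [by lia|exact: size_poly|].
  apply/polyP=> i; rewrite coef_rev !coef_poly !ltnS leq_subr; case: leqP => // l.
  rewrite -[RHS](congr1 (fun r : {poly int} => r`_i.+1) rq) coef_rev.
  by rewrite ifT; [congr (q`_ _)|]; lia.
exists ((p`_0)%:P + 'X * g).
  rewrite (leq_trans (size_polyD _ _)) // geq_max (leq_trans (size_polyC_leq1 _)) //=.
  by rewrite (leq_trans (size_polyMleq _ _)) // size_polyX.
rewrite big_ord_recl /= coefD coefC coefXM /= addr0 expr0 mul1r subn0.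
rewrite -[LHS](subrK (p`_0 *: (1 + 'X) ^+ d.+2)) -/q addrC; congr (_ + _).
rewrite eq' eg mulr_sumr; apply: eq_bigr => i _.
rewrite coefD coefC coefXM /= add0r /bump /= add1n doubleS !subSS.
by rewrite exprS -mulrA -scalerAr.
Qed.

Lemma gamma_exists (T : finType) (M : matroid T) : {g : {poly int} | is_gamma_poly M g}.
Proof.
by have [g] := gamma_expansion (Z_poly_size M) (Z_poly_palindromic M); exists g.
Qed.

Lemma gamma_unique (T : finType) (M : matroid T) (g h : {poly int}) :
  is_gamma_poly M g -> is_gamma_poly M h -> g = h.
Proof.
rewrite /is_gamma_poly; move: (rank M) (Z_poly M) => d p [sg eg] [sh eh].
have [n] := ubnP d; elim: n d p g h sg eg sh eh => // n IH d p g h sg eg sh eh ld.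
have c (f : {poly int}) : p = \sum_(i < d./2.+1) f`_i *: ('X^i * (1 + 'X) ^+ (d - i.*2)) -> p`_0 = f`_0.
  move=> ->; rewrite coef_sum big_ord_recl /= big1 ?addr0 => [|i _].
    by rewrite expr0 mul1r coefZ coef_1X_bot mulr1.
  by rewrite coefZ /bump /= add1n exprS -mulrA coefXM mulr0.
have e0 : g`_0 = h`_0 by rewrite -(c g) // -(c h).
have dec (f : {poly int}) : f = (f`_0)%:P + 'X * \poly_(i < (size f).-1) f`_i.+1.
  apply/polyP=> i; rewrite coefD coefC coefXM coef_poly.
  case: i => [|i] /=; first by rewrite addr0.
  by rewrite add0r; case: ltnP => // l; rewrite nth_default // (leq_trans (leqSpred _)).
pose s (f : {poly int}) := \poly_(i < (size f).-1) f`_i.+1.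
have cs f i : (s f)`_i = f`_i.+1.
  by rewrite coef_poly; case: ltnP => // l; rewrite nth_default // (leq_trans (leqSpred _)).
suff e : s g = s h by rewrite (dec g) (dec h) e0 -/(s g) -/(s h) e.
case: (ltnP d 2) => d2.
  have d0 : d./2 = 0%N by lia.
  rewrite d0 in sg sh; apply/polyP=> i; rewrite !cs !nth_default //.
    exact: leq_trans sh _.
  exact: leq_trans sg _.
case: d d2 ld sg sh eg eh c => [//|[//|d]] _ ld sg sh eg eh _.
pose S (f : {poly int}) := \sum_(i < d./2.+1) (s f)`_i *: ('X^i * (1 + 'X) ^+ (d - i.*2)).
have step (f : {poly int}) :
   p = \sum_(i < d.+2./2.+1) f`_i *: ('X^i * (1 + 'X) ^+ (d.+2 - i.*2)) ->
   p - f`_0 *: (1 + 'X) ^+ d.+2 = 'X * S f.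
  move=> ->; rewrite big_ord_recl /= expr0 mul1r subn0 addrC addKr mulr_sumr.
  apply: eq_bigr => i _; rewrite cs /bump /= add1n doubleS !subSS.
  by rewrite exprS -mulrA -scalerAr.
apply: (IH d (S g)) => //; last by lia.
- by rewrite (leq_trans (size_poly _ _)) //; lia.
- by rewrite (leq_trans (size_poly _ _)) //; lia.
apply: (mulfI (x := 'X)); first by rewrite -size_poly_eq0 size_polyX.
by rewrite -(step g) // -(step h) // e0.
Qed.

Definition gamma_poly (T : finType) (M : matroid T) : {poly int} :=
  sval (gamma_exists M).

Lemma gamma_polyP (T : finType) (M : matroid T) : is_gamma_poly M (gamma_poly M).
Proof. exact: svalP (gamma_exists M). Qed.

Definition gamma_positive (T : finType) (M : matroid T) : Prop :=
  forall i : nat, 0 <= (gamma_poly M)`_i.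

(* Main.v *)
Require Import Defs.
From mathcomp Require Import all_boot all_order all_algebra.
From mathcomp Require Import zify ring.
Import GRing.Theory Num.Theory.
Local Open Scope ring_scope.

(** Fix [m = n - k] and let [d] be the rank.  Contracting [j < d] elements of
    [U_{d,m+d}] gives [U_{d-j,m+d-j}], so
    [Z_d = t^d + \sum_(j < d) 'C(m + d, j) t^j P_(d-j)], and the [P_d] are
    determined by [deg P_d < d/2] together with the palindromicity of [Z_d].
    Let [Z_d] be the polynomial with the claimed gamma coefficients; it is
    palindromic.  Inverting the relation gives [P_d], and for [d/2 <= i < d] and
    [s = d - i] palindromicity of [Z_(d-j)] gives
    [ [t^i] P_d = \sum_j (-1)^j 'C(m + d, j) [t^s] Z_(d-j) ].
    For fixed [s > 0], [ [t^s] Z_D ] is a polynomial in [N = m + D] of degree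
    less than [m + 2s <= m + d] that vanishes at [N = 0, ..., m + s - 1].  The sum
    is therefore the full [(m + d)]-th finite difference of a polynomial of smaller
    degree, hence zero. *)

(** * Finite differences of polynomial functions on the naturals *)

(** The degree bound is encoded by differences, so that products, antidifferences and alternating
    binomial sums are all handled by induction on [e]. *)
Fixpoint deg_lt (e : nat) (g : nat -> rat) : Prop :=
  if e is e'.+1 then deg_lt e' (fun N => g N.+1 - g N) else forall N, g N = 0.

Lemma deg_lt_ext e f g : f =1 g -> deg_lt e f -> deg_lt e g.
Proof.
elim: e f g => [|e IH] f g efg /=; first by move=> f0 N; rewrite -efg.
by apply: IH => N; rewrite !efg.
Qed.

Lemma deg_lt0 e g : g =1 (fun=> 0) -> deg_lt e g.
Proof.
elim: e g => [|e IH] g g0 //=.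
by apply: IH => N; rewrite !g0 subrr.
Qed.

Lemma deg_ltD e f g :
  deg_lt e f -> deg_lt e g -> deg_lt e (fun N => f N + g N).
Proof.
elim: e f g => [|e IH] f g /= df dg.
  by move=> N; rewrite df dg addr0.
apply: deg_lt_ext (IH _ _ df dg) => N; ring.
Qed.

Lemma deg_lt_sum (I : Type) (r : seq I) (P : pred I) e (f : I -> nat -> rat) :
  (forall i, P i -> deg_lt e (f i)) ->
  deg_lt e (fun N => \sum_(i <- r | P i) f i N).
Proof.
move=> df; elim: r => [|i r IH].
  by apply: deg_lt0 => N; rewrite big_nil.
apply: (@deg_lt_ext _ (fun N => (if P i then f i N else 0) +
                                \sum_(i <- r | P i) f i N)).
  by move=> N; rewrite big_cons; case: (P i); rewrite ?add0r.
by apply: deg_ltD => //; case E: (P i); [apply: df | apply: deg_lt0].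
Qed.

Lemma deg_ltS e g : deg_lt e g -> deg_lt e.+1 g.
Proof.
elim: e g => [|e IH] g /=; first by move=> g0 N; rewrite !g0 subrr.
exact: IH.
Qed.

Lemma deg_ltW e e' g : (e <= e')%N -> deg_lt e g -> deg_lt e' g.
Proof.
move=> /subnK <-; elim: (e' - e)%N => // k IH dg.
by rewrite addSn; apply/deg_ltS/IH.
Qed.

Lemma deg_lt_shift e g : deg_lt e g -> deg_lt e (fun N => g N.+1).
Proof.
elim: e g => [|e IH] g /=; first by move=> g0 N; rewrite g0.
exact: IH.
Qed.

(** Induction on the sum of the two bounds through the discrete Leibniz rule; a bound of zero makes
    the product vanish. *)
Lemma deg_ltM a b f g :
  deg_lt a.+1 f -> deg_lt b.+1 g -> deg_lt (a + b).+1 (fun N => f N * g N).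
Proof.
suff main c u v : forall x y, (x + y = c)%N ->
    deg_lt x u -> deg_lt y v -> deg_lt c.-1 (fun N => u N * v N).
  move=> df dg; rewrite -addnS.
  exact: (main (a.+1 + b.+1)%N _ _ a.+1 b.+1).
have z e (p q : nat -> rat) : (p =1 fun=> 0) \/ (q =1 fun=> 0) ->
    deg_lt e (fun N => p N * q N).
  by case=> h; apply: deg_lt0 => N; rewrite h ?mul0r ?mulr0.
elim: c u v => [|c IH] u v [|x] [|y] //=; try by move=> *; apply: z; tauto.
  by move=> _ u0 _ N; rewrite u0 mul0r.
move=> exy du dv; case: c exy IH => [|c] exy IH; first by lia.
apply: (@deg_lt_ext c (fun N => (u N.+1 - u N) * v N + u N.+1 * (v N.+1 - v N))).
  by move=> N; ring.
apply: deg_ltD; first by apply: (IH _ _ x y.+1) => //; lia.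
apply: (IH _ _ x.+1 y) => //; first by lia.
exact: (@deg_lt_shift x.+1 u).
Qed.

Lemma deg_ltZ e c g : deg_lt e g -> deg_lt e (fun N => c * g N).
Proof.
case: e => [|e] dg; first by move=> N; rewrite dg mulr0.
by apply: (@deg_ltM 0 e (fun=> c)) => // N; rewrite subrr.
Qed.

Lemma deg_lt_affine (a b : rat) : deg_lt 2 (fun N => a + b * N%:R).
Proof. by move=> N /=; rewrite -!natr1; ring. Qed.

Lemma deg_lt_bin k : deg_lt k.+1 (fun N => 'C(N, k)%:R).
Proof.
elim: k => [|k IH]; first by move=> N; rewrite !bin0 subrr.
by apply: (@deg_lt_ext k.+1) IH => N; rewrite binS natrD [X in X - _]addrC addrK.
Qed.

Lemma deg_lt_antidiff e f :
  deg_lt e f -> deg_lt e.+1 (fun N => \sum_(l < N) f l).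
Proof.
by apply: (@deg_lt_ext e) => N; rewrite big_ord_recr /= [RHS]addrC addKr.
Qed.

Lemma alternating_sum_deg_lt n g : deg_lt n g ->
  \sum_(j < n.+1) (-1) ^+ j * 'C(n, j)%:R * g j = 0.
Proof.
elim: n g => [|n IH] g dg; first by rewrite big_ord1 dg mulr0.
have := IH _ dg; set S := \sum_(j < n.+1) _ => S0.
rewrite big_ord_recl bin0.
under eq_bigr do rewrite /= /bump /= add1n binS natrD.
(* After Pascal's rule, [- S] collects the differences of [g]; the bracket telescopes to [- g 0],
   which cancels the first term split off above. *)
have -> : \sum_(i < n.+1) (-1) ^+ i.+1 * ('C(n, i.+1)%:R + 'C(n, i)%:R) * g i.+1 =
    - S + (\sum_(i < n.+1) (-1) ^+ i.+1 * 'C(n, i.+1)%:R * g i.+1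
           - \sum_(i < n.+1) (-1) ^+ i * 'C(n, i)%:R * g i).
  rewrite /S -sumrN -sumrB -big_split /=; apply: eq_bigr => i _.
  rewrite exprS; ring.
rewrite big_ord_recr /= bin_small // [X in _ - X]big_ord_recl bin0.
under [X in _ - (_ + X)]eq_bigr do rewrite /= /bump /= add1n.
rewrite S0; ring.
Qed.

Lemma alternating_sum_rev n g : deg_lt n g ->
  \sum_(j < n.+1) (-1) ^+ j * 'C(n, j)%:R * g (n - j)%N = 0.
Proof.
move=> /alternating_sum_deg_lt h; rewrite (reindex_inj rev_ord_inj) /=.
rewrite -[RHS](mulr0 ((-1) ^+ n)) -{}[in RHS]h mulr_sumr.
apply: eq_bigr => -[j /= lj] _; rewrite ltnS in lj.
rewrite subSS subKn // bin_sub // !mulrA; congr (_ * _ * _).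
rewrite -[in RHS](subnK lj) exprD.
by rewrite -mulrA -expr2 sqrr_sign mulr1.
Qed.

(** * Falling factorials *)

Definition falling (x : rat) (k : nat) : rat := \prod_(l < k) (x - l%:R).

Lemma falling_nat n k : falling n%:R k = (n ^_ k)%:R.
Proof.
elim: k => [|k IH]; first by rewrite /falling big_ord0.
rewrite /falling big_ord_recr /= -/(falling _ _) IH ffactnSr natrM.
have [lkn|lnk] := leqP k n; first by rewrite natrB.
by rewrite ffact_small // !mul0r.
Qed.

Lemma falling_m1 k : falling (-1) k = (-1) ^+ k * k`!%:R.
Proof.
elim: k => [|k IH]; first by rewrite /falling big_ord0 mulr1.
rewrite /falling big_ord_recr /= -/(falling _ _) IH factS natrM exprS -natr1; ring.
Qed.

Lemma deg_lt_falling (a b : rat) k :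
  deg_lt k.+1 (fun N => falling (a + b * N%:R) k).
Proof.
elim: k => [|k IH]; first by move=> N; rewrite /falling !big_ord0 subrr.
apply: (@deg_lt_ext _ (fun N => falling (a + b * N%:R) k *
                                ((a - k%:R) + b * N%:R))).
  by move=> N; rewrite /falling big_ord_recr /=; congr (_ * _); ring.
rewrite -addn1; exact: deg_ltM IH (deg_lt_affine _ _).
Qed.

(** * The candidate gamma coefficients and Z-polynomials *)

Definition gamma_coef (m d i : nat) : rat :=
  if i == 0%N then 1 else
  ((d - i)%N%:R)^-1 * 'C(d - i, i)%:R *
  \sum_(i <= j < d) ((d - j) * 'C(j - 1, i - 1) * 'C(m + j - 1, j))%N%:R.

Definition Z_uniform (m d : nat) : {poly rat} :=
  \sum_(i < d./2.+1) gamma_coef m d i *: ('X^i * (1 + 'X) ^+ (d - i.*2)).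

Lemma coef_1DX n j : ((1 + 'X : {poly rat}) ^+ n)`_j = 'C(n, j)%:R.
Proof.
rewrite addrC exprD1n coef_sum.
under eq_bigr do rewrite coefMn coefXn.
have [ljn|lnj] := ltnP j n.+1.
  rewrite (bigD1 (Ordinal ljn)) //= eqxx big1 ?addr0 // => i ni.
  by rewrite (_ : (j == i) = false) ?mul0rn //; apply: contraNF ni => /eqP e;
     apply/eqP/val_inj.
rewrite bin_small // big1 // => i _.
by rewrite (_ : (j == i) = false) ?mul0rn //; have := ltn_ord i; lia.
Qed.

Lemma coef_Z_uniform m d s : (Z_uniform m d)`_s =
  \sum_(i < d./2.+1) gamma_coef m d i *
    (if (i <= s)%N then 'C(d - i.*2, s - i)%:R else 0).
Proof.
rewrite coef_sum; apply: eq_bigr => i _.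
by rewrite coefZ coefXnM coef_1DX ltnNge; case: leqP.
Qed.

Lemma Z_uniform_sym m d s : (s <= d)%N ->
  (Z_uniform m d)`_(d - s) = (Z_uniform m d)`_s.
Proof.
move=> lsd; rewrite !coef_Z_uniform; apply: eq_bigr => -[i /= li] _.
congr (_ * _); case: (leqP i s) => lis; case: leqP => lids //.
- rewrite -bin_sub; last by lia.
  by congr ('C(_, _)%:R); lia.
(* When only one of [s] and [d - s] is at least [i], the lower index of the remaining binomial
   exceeds the upper one. *)
- by rewrite bin_small //; lia.
- by rewrite bin_small //; lia.
Qed.

Lemma Z_uniform_small m d s : (d < s)%N -> (Z_uniform m d)`_s = 0.
Proof.
move=> lds; rewrite coef_Z_uniform big1 // => -[i /= li] _.
by case: leqP => _; rewrite ?mulr0 // bin_small ?mulr0 //; lia.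
Qed.

Lemma Z_uniform_coef0 m d : (Z_uniform m d)`_0 = 1.
Proof.
rewrite coef_Z_uniform big_ord_recl big1 => [|i _]; last by rewrite mulr0.
by rewrite /gamma_coef /= bin0 mulr1 addr0.
Qed.

(** * Coefficients of the candidate Z-polynomials as polynomials in m + d *)

(* For [0 < i] and [0 < m], the second difference of the inner sum of
   [gamma_coef m d i], as a polynomial in [N = m + d]. *)
Definition weight (m i l : nat) : rat :=
  'C(l, m.-1)%:R * falling (- m%:R + 1 * l%:R) i.-1 * (i.-1)`!%:R^-1.

(* The polynomial in [N] interpolating the inner sum of [gamma_coef m d i] at
   [N = m + d], for all [d >= 0]. The value at [i = 0] makes the constant gamma
   coefficient fit the same pattern: [gamma_coefM] then holds for [i = 0] too. *)
Definition inner_poly (m i N : nat) : rat :=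
  if i == 0%N then N%:R - m%:R else if m == 0%N then 0 else
  (-1) ^+ i * (N%:R - m%:R) + \sum_(J < N) \sum_(l < J) weight m i l.

(** In the range of [gamma_coefM], the product of 1/(d - i), C(d - i, i) and C(d - 2i, s - i) is the
    falling factorial of d - i - 1 of length s - 1, divided by i! (s - i)!. Here d is replaced by N
    - m. *)
Definition coef_term (m s i N : nat) : rat :=
  (i`! * (s - i)`!)%N%:R^-1 * falling (- (m + i.+1)%N%:R + 1 * N%:R) s.-1
  * inner_poly m i N.

Definition coef_poly_fun (m s N : nat) : rat := \sum_(i < s.+1) coef_term m s i N.

(** For positive [m] and [i], [weight] has degree at most (m - 1) + (i - 1), and two summations
    raise this to m + i. At [i = 0] the function is linear, and the extra one in the bound covers
    [m = 0]. *)
Lemma deg_lt_inner_poly m i : deg_lt (m + i + (i == 0%N)).+1 (inner_poly m i).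
Proof.
rewrite /inner_poly; case: eqP => [->|/eqP i0].
  rewrite addn0 addn1; apply: (@deg_ltW 2); first by lia.
  by apply: deg_lt_ext (deg_lt_affine (- m%:R) 1) => N; ring.
rewrite addn0; case: eqP => [_|/eqP m0]; first exact: deg_lt0.
apply: deg_ltD.
  apply: deg_ltZ; apply: (@deg_ltW 2); first by lia.
  by apply: deg_lt_ext (deg_lt_affine (- m%:R) 1) => N; ring.
have -> : (m + i).+1 = (m.-1 + i.-1).+1.+2 by lia.
apply: (@deg_lt_antidiff _ (fun J => \sum_(l < J) weight m i l)).
apply: (@deg_lt_antidiff _ (weight m i)).
apply: (@deg_lt_ext _ (fun l => (i.-1)`!%:R^-1 *
   ('C(l, m.-1)%:R * falling (- m%:R + 1 * l%:R) i.-1))).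
  by move=> N; rewrite mulrC.
apply: deg_ltZ; apply: deg_ltM (deg_lt_bin _) (deg_lt_falling _ _ _).
Qed.

(** The falling factorial contributes degree s - 1, and [inner_poly] at most m + s because i <= s
    (for i = 0 its degree is 1). *)
Lemma deg_lt_coef_poly_fun m s : (0 < s)%N ->
  deg_lt (m + s.*2) (coef_poly_fun m s).
Proof.
move=> s0; apply: deg_lt_sum => -[i /= li] _; rewrite /coef_term.
apply: (@deg_lt_ext _ (fun N => (i`! * (s - i)`!)%N%:R^-1 *
   (falling (- (m + i.+1)%N%:R + 1 * N%:R) s.-1 * inner_poly m i N))).
  by move=> N; rewrite mulrA.
apply: deg_ltZ.
apply: (@deg_ltW (s.-1 + (m + i + (i == 0%N))).+1); first by case: eqP; lia.
exact: deg_ltM (deg_lt_falling _ _ _) (deg_lt_inner_poly _ _).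
Qed.

Lemma sum_sum_ord (f : nat -> rat) N :
  \sum_(J < N) \sum_(l < J) f l = \sum_(l < N) (N.-1 - l)%N%:R * f l.
Proof.
elim: N => [|N IH]; first by rewrite !big_ord0.
rewrite !big_ord_recr /= subnn mul0r addr0 IH -big_split /=.
apply: eq_bigr => l _; have := ltn_ord l => ll.
have -> : (N - l = (N.-1 - l).+1)%N by lia.
by rewrite -natr1; ring.
Qed.

Lemma weight_small m i l : (0 < m)%N -> (l < m.-1)%N -> weight m i l = 0.
Proof. by move=> m0 ll; rewrite /weight bin_small // !mul0r. Qed.

(** At [l = m.-1] the weight is nonzero although the inner sum of [gamma_coef] has no matching term;
    the linear part of [inner_poly] is there to offset it. *)
Lemma weight_pred m i : (0 < m)%N -> (0 < i)%N -> weight m i m.-1 = - (-1) ^+ i.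
Proof.
move=> m0 i0; rewrite /weight.
have -> : - m%:R + 1 * m.-1%:R = -1 :> rat.
  by rewrite -{1}(prednK m0) -natr1; ring.
rewrite binn mul1r falling_m1 mulfK; first by rewrite -{2}(prednK i0) exprS; ring.
by rewrite pnatr_eq0 -lt0n fact_gt0.
Qed.

Lemma weight_large m i j : (0 < m)%N -> (0 < i)%N ->
  weight m i (m + j) = ('C(j, i - 1) * 'C(m + j.+1 - 1, j.+1))%N%:R.
Proof.
move=> m0 i0; rewrite /weight.
have -> : - m%:R + 1 * (m + j)%N%:R = j%:R :> rat by rewrite natrD; ring.
rewrite falling_nat -bin_ffact !natrM !mulrA mulfK ?subn1; last first.
  by rewrite pnatr_eq0 -lt0n fact_gt0.
rewrite mulrC; congr (_ * _%:R).
rewrite addnS /= -bin_sub; last by lia.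
by congr ('C(_, _)); lia.
Qed.

Lemma inner_poly_large m i d : (0 < i)%N ->
  inner_poly m i (m + d) =
  \sum_(i <= j < d) ((d - j) * 'C(j - 1, i - 1) * 'C(m + j - 1, j))%N%:R.
Proof.
move=> i0; rewrite /inner_poly (negPf (lt0n_neq0 i0)); case: eqP => [->|/eqP].
  rewrite big_nat big1 // => j /andP[lij _].
  by rewrite add0n (@bin_small (j - 1) j) ?muln0 //; lia.
rewrite -lt0n => m0; rewrite sum_sum_ord.
rewrite -(big_mkord predT (fun l => ((m + d).-1 - l)%N%:R * weight m i l)).
rewrite (@big_cat_nat _ _ _ m.-1) //=; last by lia.
rewrite big_nat big1 => [|l /andP[_ ll]]; last by rewrite weight_small ?mulr0.
rewrite big_ltn; last by lia.
rewrite prednK //.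
rewrite add0r weight_pred //.
have -> : ((m + d).-1 - m.-1)%N = d by lia.
rewrite natrD.
(* The weight at [m.-1] is counted [d] times and cancels the linear part. *)
have -> : forall S : rat, (-1) ^+ i * (m%:R + d%:R - m%:R) + (d%:R * - (-1) ^+ i + S) = S.
  by move=> S; ring.
rewrite -{1}[m]add0n big_addn addKn.
case: d => [|d]; first by rewrite !big_geq.
rewrite big_nat_recr //= [in X in _ + X](_ : _ - _ = 0)%N ?mul0r ?addr0; last by lia.
(* Let the target sum start at 1; the indices below [i] correspond to vanishing weights. *)
rewrite (@big_nat_widenl _ _ _ i 1) //=.
rewrite big_add1 /= [RHS]big_mkcond /=; apply: eq_big_nat => j /andP[_ lj].
rewrite (addnC j) weight_large // -!natrM.
have [lij|lji] := leqP i j.+1.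
  by rewrite mulnA; congr (_ * 'C(_, _) * _)%N%:R; lia.
by rewrite (@bin_small j (i - 1)) ?mul0n ?muln0 //; lia.
Qed.

Lemma inner_poly_neg m i N : (N < m)%N ->
  inner_poly m i N = (-1) ^+ i * (N%:R - m%:R).
Proof.
move=> lN; rewrite /inner_poly; case: eqP => [->|_]; first by rewrite mul1r.
case: eqP => [m0|_]; first by lia.
rewrite [X in _ + X]big1 ?addr0 // => J _; rewrite big1 // => l _.
by apply: weight_small; have := ltn_ord l; have := ltn_ord J; lia.
Qed.

(* For [N < m] the value is [(N - m) / s`!] times the [s]-th finite difference in [i]
   of a polynomial of degree [s - 1]. *)
Lemma coef_poly_fun_vanish m s N : (0 < s)%N -> (N < m + s)%N ->
  coef_poly_fun m s N = 0.
Proof.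
move=> s0 lN; have [lNm|lmN] := ltnP N m.
  rewrite /coef_poly_fun.
  have ds : deg_lt s (fun i => falling (N%:R - m%:R - 1 + (-1) * i%:R) s.-1).
    by have := deg_lt_falling (N%:R - m%:R - 1) (-1) s.-1; rewrite (prednK s0).
  rewrite -[RHS](mulr0 ((N%:R - m%:R) / s`!%:R)) -[in RHS](alternating_sum_deg_lt _ _ ds).
  rewrite mulr_sumr; apply: eq_bigr => -[i /= li] _.
  rewrite /coef_term inner_poly_neg //.
  have -> : - (m + i.+1)%N%:R + 1 * N%:R = N%:R - m%:R - 1 + (-1) * i%:R :> rat.
    by rewrite natrD -natr1; ring.
  have e : s`!%:R = 'C(s, i)%:R * (i`! * (s - i)`!)%N%:R :> rat.
    by rewrite -natrM bin_fact.
  rewrite e; have n0 : 'C(s, i)%:R != 0 :> rat by rewrite pnatr_eq0 -lt0n bin_gt0.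
  have n1 : (i`! * (s - i)`!)%N%:R != 0 :> rat.
    by rewrite pnatr_eq0 -lt0n muln_gt0 !fact_gt0.
  move: ((i`! * (s - i)`!)%N%:R : rat) ('C(s, i)%:R) n0 n1 => a b n0 n1.
  by field; rewrite n0 n1.
rewrite -(subnKC lmN) in lN *; move: (N - m)%N lN => D {lmN N}; rewrite ltn_add2l => lDs.
rewrite /coef_poly_fun big1 // => -[i /= li] _; rewrite /coef_term.
(* Now N = m + D with D < s. If D <= i, the inner sum is empty, or N - m = 0 when i = 0; otherwise D
   - i - 1 < s - 1 kills the falling factorial. *)
have [lDi|liD] := leqP D i.
  have [i0|i0] := posnP i.
    have D0 : D = 0%N by lia.
    by rewrite i0 D0 addn0 /inner_poly /= subrr mulr0.
  by rewrite inner_poly_large // big_geq ?mulr0.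
have -> : - (m + i.+1)%N%:R + 1 * (m + D)%N%:R = (D - i.+1)%N%:R :> rat.
  by rewrite natrB // !natrD; ring.
rewrite falling_nat ffact_small ?mulr0 ?mul0r //; lia.
Qed.

Lemma gamma_coefM m d s i : (i <= d./2)%N -> (i <= s)%N -> (0 < s <= d)%N ->
  gamma_coef m d i * 'C(d - i.*2, s - i)%:R = coef_term m s i (m + d).
Proof.
move=> lid lis /andP[s0 lsd]; rewrite /coef_term.
have id : (i < d)%N by lia.
have -> : - (m + i.+1)%N%:R + 1 * (m + d)%N%:R = (d - i.+1)%N%:R :> rat.
  by rewrite natrB // !natrD; ring.
rewrite falling_nat.
have nzf a : a`!%:R != 0 :> rat by rewrite pnatr_eq0 -lt0n fact_gt0.
have n2 : (i`! * (s - i)`!)%N%:R != 0 :> rat by rewrite natrM mulf_neq0.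
have nd : (d - i)%N%:R != 0 :> rat by rewrite pnatr_eq0; lia.
have key : ('C(d - i, i) * 'C(d - i.*2, s - i) * (i`! * (s - i)`!) =
            (d - i) * (d - i.+1) ^_ s.-1)%N.
  (* If s > d - i, both sides are zero. Otherwise multiplying by (d - i - s)! turns each side into
     (d - i)!. *)
  have [l|l] := leqP s (d - i); last first.
    rewrite [('C(d - i.*2, _))%N]bin_small; last by lia.
    by rewrite ffact_small ?muln0 ?mul0n //; lia.
  have f1 : ('C(d - i, i) * (i`! * (d - i.*2)`!) = (d - i)`!)%N.
    by rewrite -[RHS](@bin_fact (d - i) i); [congr (_ * (_ * _`!))%N; lia|lia].
  have f2 : ('C(d - i.*2, s - i) * ((s - i)`! * (d - i - s)`!) = (d - i.*2)`!)%N.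
    by rewrite -[RHS](@bin_fact (d - i.*2) (s - i)); [congr (_ * (_ * _`!))%N; lia|lia].
  have f3 : ((d - i.+1) ^_ s.-1 * (d - i - s)`! = (d - i.+1)`!)%N.
    by rewrite -[RHS](@ffact_fact (d - i.+1) s.-1); [congr (_ * _`!)%N; lia|lia].
  have f4 : ((d - i)`! = (d - i) * (d - i.+1)`!)%N.
    by rewrite -[in LHS](@prednK (d - i)) ?factS; [congr (_ * _`!)%N; lia|lia].
  apply/eqP; rewrite -(eqn_pmul2r (fact_gt0 (d - i - s))); apply/eqP.
  by rewrite -(mulnA (d - i)%N) f3 -f4 -f1 -f2; ring.
have {}key : 'C(d - i, i)%:R * 'C(d - i.*2, s - i)%:R =
   (d - i)%N%:R * ((i`! * (s - i)`!)%N%:R^-1 * ((d - i.+1) ^_ s.-1)%:R) :> rat.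
  apply: (mulIf n2); rewrite -natrM -natrM key natrM.
  by rewrite -mulrA [_^-1 * _]mulrC mulfVK.
have [i0|i0] := posnP i.
  rewrite /gamma_coef i0 /= mul1r /inner_poly /=; move: key nd; rewrite i0 /= bin0 mul1r.
  by rewrite !subn0 natrD => -> _; ring.
rewrite inner_poly_large // /gamma_coef (negPf (lt0n_neq0 i0)).
set S := \sum_(_ <= _ < _) _.
transitivity ((d - i)%N%:R^-1 * ('C(d - i, i)%:R * 'C(d - i.*2, s - i)%:R) * S); first by ring.
by rewrite key mulKf.
Qed.

(** Only the summation ranges differ. For d/2 < i <= s the extra [coef_term] vanishes: the inner sum
    is empty when d <= i, and otherwise d - i - 1 < s - 1 kills the falling factorial. *)
Lemma coef_Z_uniform_poly m d s : (0 < s <= d)%N ->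
  (Z_uniform m d)`_s = coef_poly_fun m s (m + d).
Proof.
move=> /andP[s0 lsd]; rewrite coef_Z_uniform /coef_poly_fun.
pose K := maxn d./2.+1 s.+1.
transitivity (\sum_(i < K | (i <= d./2)%N && (i <= s)%N) coef_term m s i (m + d)).
  rewrite (big_ord_widen K (fun i => gamma_coef m d i *
    (if (i <= s)%N then 'C(d - i.*2, s - i)%:R else 0))) ?leq_maxl //.
  rewrite [RHS]big_mkcondr /=; apply: eq_big => i; first by rewrite ltnS.
  rewrite ltnS => lid; case: leqP => lis; last by rewrite mulr0.
  by rewrite gamma_coefM // s0.
rewrite (big_ord_widen K (fun i => coef_term m s i (m + d))) ?leq_maxr //.
rewrite big_mkcondl /=; apply: eq_big => i; first by rewrite ltnS.
move=> lis; case: leqP => // ldi; rewrite /coef_term.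
have [ldi'|lid] := leqP d i.
  by rewrite inner_poly_large ?big_geq ?mulr0 //; lia.
have -> : - (m + i.+1)%N%:R + 1 * (m + d)%N%:R = (d - i.+1)%N%:R :> rat.
  by rewrite natrB // !natrD; ring.
rewrite falling_nat ffact_small ?mulr0 ?mul0r //; lia.
Qed.

Lemma Z_uniform_alternating m d s : (0 < s)%N -> (s.*2 <= d)%N ->
  \sum_(j < (d - s).+1) (-1) ^+ j * 'C(m + d, j)%:R * (Z_uniform m (d - j))`_s = 0.
Proof.
move=> s0 lsd.
have dg : deg_lt (m + d) (coef_poly_fun m s).
  by apply: deg_ltW (deg_lt_coef_poly_fun _ _ s0); lia.
rewrite -[RHS](alternating_sum_rev _ _ dg).
rewrite (big_ord_widen (m + d).+1 (fun j => (-1) ^+ j * 'C(m + d, j)%:R *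
   (Z_uniform m (d - j))`_s)); last by lia.
rewrite big_mkcond /=; apply: eq_bigr => j _; case: ltnP => lj.
  rewrite coef_Z_uniform_poly; last by lia.
  by rewrite addnBA //; lia.
(* For j > d - s the argument m + d - j is below m + s, so completing the sum adds only zeros. *)
rewrite coef_poly_fun_vanish ?mulr0 //; lia.
Qed.

(** * The candidate Kazhdan-Lusztig polynomials and binomial inversion *)

Definition P_uniform (m d : nat) : {poly rat} :=
  \sum_(j < d) ((-1) ^+ j * 'C(m + d, j)%:R) *:
    ('X^j * (Z_uniform m (d - j) - 'X^(d - j))).

Lemma P_uniform_small m d i : (d <= i.*2)%N -> (P_uniform m d)`_i = 0.
Proof.
move=> ldi; rewrite coef_sum.
under eq_bigr do rewrite coefZ coefXnM coefB coefXn.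
have [lid|ldi'] := ltnP i d; last first.
  (* For i >= d only degrees at least d - j occur; by symmetry the top coefficient of
     [Z_uniform m (d - j)] is its constant term 1, which the subtracted power removes. *)
  rewrite big1 // => -[j /= lj] _; case: ltnP => lji; first by rewrite mulr0.
  have [e|e] := eqVneq (i - j)%N (d - j)%N.
    have := @Z_uniform_sym m (d - j) 0 isT; rewrite subn0 e => ->.
    by rewrite Z_uniform_coef0 subrr mulr0.
  by rewrite Z_uniform_small ?subrr ?mulr0 //; lia.
(* Take s = d - i: reflecting [Z_uniform m (d - j)] sends degree i - j to s. *)
rewrite -[RHS](@Z_uniform_alternating m d (d - i)); [|lia|lia].
rewrite subKn 1?ltnW //.
rewrite (big_ord_widen d (fun j => (-1) ^+ j * 'C(m + d, j)%:R *
   (Z_uniform m (d - j))`_(d - i))) //.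
rewrite [RHS]big_mkcond /=; apply: eq_bigr => -[j /= lj] _.
rewrite [(j < i.+1)%N]ltnS; case: leqP => lji; last by rewrite mulr0.
rewrite (_ : (_ == _) = false) ?subr0; last by lia.
congr (_ * _); rewrite -Z_uniform_sym; last by lia.
by congr (_`_ _); lia.
Qed.

Lemma alternating_bin r :
  \sum_(j < r.+1) (-1) ^+ (r - j) * 'C(r, j)%:R = (r == 0%N)%:R :> rat.
Proof.
have := exprDn (-1 : rat) 1 r; rewrite addNr expr0n => ->.
by apply: eq_bigr => j _; rewrite expr1n mulr1 mulr_natr.
Qed.

(** With r = j + l, C(m + d, j) C(m + d - j, l) = C(m + d, r) C(r, j), and the alternating sum over
    j leaves only r = 0. *)
Lemma P_uniform_inversion m d :
  \sum_(j < d) 'C(m + d, j)%:R *: ('X^j * P_uniform m (d - j)) =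
  if d == 0%N then 0 else Z_uniform m d - 'X^d.
Proof.
pose Y r := Z_uniform m (d - r) - 'X^(d - r).
transitivity (\sum_(j < d) \sum_(r < d | (j <= r)%N)
   ('C(m + d, r)%:R * ((-1) ^+ (r - j) * 'C(r, j)%:R)) *: ('X^r * Y r)).
  apply: eq_bigr => -[j /= lj] _.
  rewrite -(big_geq_mkord _ _ predT (fun r => ('C(m + d, r)%:R *
     ((-1) ^+ (r - j) * 'C(r, j)%:R)) *: ('X^r * Y r))).
  rewrite -[X in \sum_(X <= _ < _) _]add0n big_addn big_mkord /P_uniform mulr_sumr scaler_sumr.
  apply: eq_bigr => -[l /= ll] _.
  rewrite -scalerAr scalerA ['X^j * (_ * _)]mulrA -exprD (addnC j) addnK /Y.
  have -> : (d - j - l = d - (l + j))%N by lia.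
  congr (_ *: _); rewrite mulrCA [RHS]mulrCA; congr (_ * _); rewrite -!natrM.
  congr (_%:R); apply/eqP.
  (* Once the denominators are cleared, both sides are (m + d)!. *)
  rewrite -(eqn_pmul2r (fact_gt0 l)) -(eqn_pmul2r (fact_gt0 j)).
  rewrite -(eqn_pmul2r (fact_gt0 (m + d - (l + j)))); apply/eqP.
  have f1 := @bin_fact (m + d) j; have f2 := @bin_fact (m + (d - j)) l.
  have f3 := @bin_fact (m + d) (l + j); have f4 := @bin_fact (l + j) j.
  rewrite addnK in f4.
  have e : (m + (d - j) - l = m + d - (l + j))%N by lia.
  rewrite e in f2; have e' : (m + (d - j) = m + d - j)%N by lia.
  rewrite e' in f2 *.
  transitivity ((m + d)`!)%N.
    by rewrite -f1 -1?f2; [ring|lia|lia].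
  by rewrite -f3 -1?f4; [ring|lia|lia].
rewrite (exchange_big_dep predT) //=.
transitivity (\sum_(r < d) ('C(m + d, r)%:R * (r == 0%N :> nat)%:R) *: ('X^r * Y r)).
  apply: eq_bigr => -[r /= lr] _; rewrite -scaler_suml -mulr_sumr -alternating_bin.
  congr (_ * _ *: _).
  rewrite [RHS](big_ord_widen d (fun j => (-1) ^+ (r - j) * 'C(r, j)%:R)) //.
case: d @Y => [|d] Y; first by rewrite big_ord0.
rewrite big_ord_recl big1 => [|i _]; last by rewrite mulr0 scale0r.
by rewrite bin0 mulr1 scale1r mul1r addr0 /Y subn0.
Qed.

(** * Matroids that are uniform on their ground set *)

(** A contraction keeps the carrier type [T], so a contraction of [uniform k n] need not be
    literally of that form. This class is stable under contracting at most [d] elements, with [m]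
    fixed. *)
Definition uniform_like (m d : nat) (T : finType) (M : matroid T) : Prop :=
  #|ground M| = (m + d)%N /\
  forall A : {set T}, A \subset ground M -> rk M A = minn #|A| d.

Lemma uniform_like_uniform k n : (k <= n)%N -> uniform_like (n - k) k _ (uniform k n).
Proof.
move=> lkn; split=> [|A _]; last exact: rk_uniform.
by rewrite /= cardsT card_ord subnK.
Qed.

Lemma rank_uniform_like m d T M : uniform_like m d T M -> rank M = d.
Proof. by case=> cE rE; rewrite /rank rE // cE; lia. Qed.

Lemma uniform_like_contraction m d T M (F : {set T}) :
  uniform_like m d T M -> F \subset ground M -> (#|F| <= d)%N ->
  uniform_like m (d - #|F|) T (contraction M F).
Proof.
case=> cE rE sF lF; split=> [|A sA] /=.
  by rewrite cardsD (setIidPr sF) cE; lia.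
move: sA; rewrite /= subsetD => /andP[sA dAF].
rewrite rk_contraction !rE ?subUset ?sA ?sF //.
have := cardsUI A F; move: dAF; rewrite -setI_eq0 => /eqP ->; rewrite cards0; lia.
Qed.

Lemma flats_uniform_like m d T M (F : {set T}) : uniform_like m d T M ->
  (F \in flats M) = (F \subset ground M) && ((#|F| < d)%N || (F == ground M)).
Proof.
case=> cE rE; apply/flatP/andP => -[sF h]; split=> //.
  case: ltnP => //= ldF; rewrite eqEsubset sF /=; apply/subsetP => x xE.
  apply/negPn/negP => xF; have := h x xE xF.
  by rewrite !rE ?subUset ?sub1set ?xE ?sF //; lia.
move=> x xE xF; case/orP: h => [lF|/eqP e]; last by rewrite e xE in xF.
by rewrite !rE ?subUset ?sub1set ?xE ?sF // cardsU1 xF; lia.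
Qed.

Lemma sum_subsets_card (V : nmodType) (T : finType) (E : {set T}) (d : nat)
    (f : nat -> V) :
  \sum_(F : {set T} | (F \subset E) && (#|F| < d)%N) f #|F| =
  \sum_(j < d) f j *+ 'C(#|E|, j).
Proof.
case: d => [|d]; first by rewrite big_ord0 big1 // => F; rewrite ltn0 andbF.
rewrite (partition_big (fun F : {set T} => inord #|F| : 'I_d.+1) predT) //=.
apply: eq_bigr => j _; rewrite -cards_draws -sumr_const.
apply: eq_big => F; last first.
  by move=> /andP[/andP[_ lF] /eqP <-]; rewrite inordK.
rewrite inE -andbA; congr (_ && _); apply/andP/eqP => [[lF /eqP <-]|e].
  by rewrite inordK.
have lF : (#|F| < d.+1)%N by rewrite e.
by split=> //; apply/eqP/val_inj; rewrite /= inordK.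
Qed.

(** * Kazhdan-Lusztig and Z-polynomials of uniform matroids *)

Local Notation toQ p := (map_poly (intr : int -> rat) p).

(** [p] is left free because, during the induction on rank, its value at the empty flat is the still
    unknown polynomial of [M] itself. The term ['X^d] comes from the flat [ground M]. *)
Lemma Z_poly_uniform_like m d T (M : matroid T) (p : nat -> {poly rat}) :
  uniform_like m d T M ->
  (forall F : {set T}, F \subset ground M -> (#|F| < d)%N ->
     toQ (kl_poly (contraction M F)) = p #|F|) ->
  toQ (Z_poly M) = \sum_(j < d) 'C(m + d, j)%:R *: ('X^j * p j) + 'X^d.
Proof.
move=> uM hp; have [cE rE] := uM; rewrite /Z_poly.
rewrite (bigD1 (ground M)) /=; last first.
  by rewrite (flats_uniform_like _ _ _ _ _ uM) subxx eqxx orbT.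
have -> : kl_poly (contraction M (ground M)) = 1.
  have [h _ _] := kl_polyP (contraction M (ground M)).
  by rewrite h /rank /= setDv ?eqxx // rk_contraction set0U subnn.
rewrite mulr1 -/(rank M) (rank_uniform_like _ _ _ _ uM) rmorphD /= map_polyXn addrC.
congr (_ + _); rewrite rmorph_sum /=.
rewrite (eq_bigl (fun F : {set T} => (F \subset ground M) && (#|F| < d)%N)); last first.
  move=> F; rewrite (flats_uniform_like _ _ _ _ _ uM); case: eqVneq => [->|_].
    by rewrite cE andbF; apply/esym/negbTE; rewrite negb_and; lia.
  by rewrite orbF andbT.
transitivity (\sum_(F : {set T} | (F \subset ground M) && (#|F| < d)%N) ('X^#|F| * p #|F|)).
  apply: eq_bigr => F /andP[sF lF]; rewrite rmorphM /= map_polyXn hp // rE //.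
  by congr ('X^_ * _); lia.
rewrite (sum_subsets_card _ _ _ _ (fun j => 'X^j * p j)) cE.
by apply: eq_bigr => j _; rewrite scaler_nat.
Qed.

(** By induction the terms of all nonempty flats agree, so the true and candidate Z-polynomials
    differ exactly as the true and candidate Kazhdan-Lusztig polynomials do. This difference is
    palindromic for degree [d] and has degree below d/2, hence is zero. *)
Lemma kl_poly_uniform_like m d T (M : matroid T) :
  (0 < d)%N -> uniform_like m d T M -> toQ (kl_poly M) = P_uniform m d.
Proof.
have [n] := ubnP d; elim: n d M => // n IH d M ldn d0 uM.
pose p j := if j == 0%N then toQ (kl_poly M) else P_uniform m (d - j).
have hp (F : {set T}) : F \subset ground M -> (#|F| < d)%N ->
    toQ (kl_poly (contraction M F)) = p #|F|.
  rewrite /p => sF lF; case: eqP => [/eqP|/eqP F0].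
    by rewrite cards_eq0 => /eqP ->; rewrite contraction0.
  apply: IH; [by lia|by lia|].
  by apply: uniform_like_contraction => //; lia.
have eZ := Z_poly_uniform_like _ _ _ _ _ uM hp.
have rM := rank_uniform_like _ _ _ _ uM.
have eD : toQ (Z_poly M) - Z_uniform m d = toQ (kl_poly M) - P_uniform m d.
  have := P_uniform_inversion m d; rewrite (negPf (lt0n_neq0 d0)) => /eqP.
  rewrite eq_sym subr_eq => /eqP ->; rewrite eZ.
  case: d d0 {ldn uM hp eZ rM} @p => // d _ p.
  rewrite !big_ord_recl /= !bin0 !scale1r !mul1r !subn0.
  under eq_bigr do rewrite /p /=.
  rewrite opprD addrACA subrr addr0 opprD addrACA; set A := \sum_(i < d) _.
  by rewrite subrr addr0.
have hP i : (d <= i.*2)%N -> (toQ (kl_poly M) - P_uniform m d)`_i = 0.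
  move=> ldi; rewrite coefB coef_map P_uniform_small // subr0.
  have [_ h _] := kl_polyP M; rewrite rM in h.
  by rewrite nth_default //=; have := h d0; move: (size _) => z; lia.
apply/eqP; rewrite -subr_eq0; apply/eqP/polyP => i; rewrite coef0.
have [ldi|lid] := leqP d i.*2; first exact: hP.
(* Below d/2, reflect to degree d - i, where [hP] applies. *)
rewrite -eD coefB -(Z_uniform_sym m d i); last by lia.
rewrite coef_map -(Z_poly_palindromic M) coef_rev rM ifT; last by lia.
by rewrite -coef_map -coefB eD hP //; lia.
Qed.

Lemma Z_poly_uniform m d T (M : matroid T) :
  uniform_like m d T M -> toQ (Z_poly M) = Z_uniform m d.
Proof.
move=> uM; rewrite (Z_poly_uniform_like _ _ _ _ (fun j => P_uniform m (d - j)) uM).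
  rewrite P_uniform_inversion; case: eqP => [->|_]; last by rewrite subrK.
  by rewrite add0r /Z_uniform big_ord1 /gamma_coef /= scale1r mul1r !expr0.
move=> F sF lF; apply: kl_poly_uniform_like; first by lia.
by apply: uniform_like_contraction => //; lia.
Qed.

(** * Reading off the gamma coefficients *)

(** The family is triangular: whatever [e i] is, the lowest term of the [i]-th member is ['X^i] with
    coefficient 1. *)
Lemma gamma_basis_free (n : nat) (e : nat -> nat) (c : nat -> rat) :
  \sum_(i < n) c i *: ('X^i * (1 + 'X) ^+ e i) = 0 ->
  forall i, (i < n)%N -> c i = 0.
Proof.
move=> h i; elim/ltn_ind: i => i IH lin.
have := congr1 (fun p : {poly rat} => p`_i) h; rewrite coef0 coef_sum.
rewrite (bigD1 (Ordinal lin)) //= coefZ coefXnM ltnn subnn coef_1DX bin0 mulr1.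
rewrite big1 ?addr0 // => -[j /= lj] nj; have {}nj : j != i by [].
rewrite coefZ coefXnM; case: ltnP => lij; first by rewrite mulr0.
by rewrite IH ?mul0r //; lia.
Qed.

Lemma gamma_poly_uniform k n i : (k <= n)%N -> (i <= k./2)%N ->
  ((gamma_poly (uniform k n))`_i)%:~R = gamma_coef (n - k) k i.
Proof.
move=> lkn lik; have [_] := gamma_polyP (uniform k n).
rewrite rank_uniform // => /(congr1 (fun p => toQ p)).
rewrite (Z_poly_uniform _ _ _ _ (uniform_like_uniform _ _ lkn)) rmorph_sum /=.
set g := gamma_poly _ => e; apply/eqP; rewrite -subr_eq0; apply/eqP.
pose c j := (g`_j)%:~R - gamma_coef (n - k) k j.
apply: (gamma_basis_free k./2.+1 (fun i => k - i.*2)%N c) => //.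
under eq_bigr do rewrite scalerBl.
rewrite sumrB -/(Z_uniform _ _) e; apply/eqP; rewrite subr_eq0; apply/eqP.
apply: eq_bigr => j _.
by rewrite map_polyZ rmorphM /= map_polyXn rmorphXn /= rmorphD rmorph1 /= map_polyX.
Qed.

Theorem theorem5p10 (k n : nat) (hkn : (k <= n)%N) :
  gamma_positive (uniform k n) /\
  (gamma_poly (uniform k n))`_0 = 1 /\
  forall i : nat, (0 < i)%N -> (i < k)%N ->
    ((gamma_poly (uniform k n))`_i)%:~R =
      ((k - i)%N%:R)^-1 * 'C(k - i, i)%:R *
      (\sum_(i <= j < k)
         ((k - j) * 'C(j - 1, i - 1) * 'C(n - k + j - 1, j))%N%:R) :> rat.
Proof.
have high i : (k./2 < i)%N -> (gamma_poly (uniform k n))`_i = 0.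
  have [sg _] := gamma_polyP (uniform k n); rewrite rank_uniform // in sg.
  by move=> ki; rewrite nth_default // (leq_trans sg).
split=> [i|].
  have [ki|/high -> //] := leqP i k./2.
  rewrite -(ler0z rat) gamma_poly_uniform // /gamma_coef; case: ifP => // _.
  by rewrite !mulr_ge0 ?invr_ge0 ?ler0n ?sumr_ge0 // => j _; rewrite ler0n.
split=> [|i i0 ik].
  by apply: (@intr_inj rat); rewrite gamma_poly_uniform.
have [ki|ki] := leqP i k./2.
  by rewrite gamma_poly_uniform // /gamma_coef (negPf (lt0n_neq0 i0)).
(* Beyond k/2 the formula also gives zero, since C(k - i, i) = 0. *)
by rewrite high // (@bin_small (k - i) i) ?mulr0 ?mul0r //; lia.
Qed.
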